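(* Let $A$ be an $m$-by-$n$ $(0,1,\ast)$-matrix, let $s$ be the maximum number of stars in a row of $A$, and let $L\subseteq\{0,1\}^n$ be a solution for $A$. If $L$ contains a linear subspace $W$ of co-distance at least $s+1$, then $L$ is contained in some linear solution for $A$.
   Context: A $(0,1,\ast)$-matrix is a matrix with entries in $\{0,1,\ast\}$; all arithmetic is over $GF_2$. A completion of $A$ is a $(0,1)$-matrix obtained from $A$ by replacing each $\ast$ by $0$ or $1$. For $A=(a_{ij})$, an operator $G=(g_1,\dots,g_m):\{0,1\}^n\to\{0,1\}^m$ is consistent with $A$ if each $g_i$ depends only on the variables $x_j$ with $a_{ij}=\ast$. A set $L\subseteq\{0,1\}^n$ is a solution for $A$ if there exist a completion $M$ of $A$ and an operator $G$ consistent with $A$ such that $M\mathbf{x}=G(\mathbf{x})$ for all $\mathbf{x}\in L$; a solution is linear if it is a linear subspace of $GF_2^n$. The co-distance of a linear subspace $W\subseteq GF_2^n$ is the smallest number of $1$'s in a nonzero vector of its orthogonal complement $W^\perp=\{\mathbf{y}:\langle\mathbf{x},\mathbf{y}\rangle=0\ \forall\mathbf{x}\in W\}$ (taken as $+\infty$ if $W^\perp=\{\mathbf{0}\}$). *)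

(* Defs.v *)
From HB Require Import structures.
From mathcomp Require Import all_boot all_order all_algebra.

Set Implicit Arguments.
Unset Strict Implicit.
Unset Printing Implicit Defensive.

Import GRing.Theory.
Local Open Scope ring_scope.

(* A (0,1,star)-matrix is a matrix over [option 'F_2], where [None] is the
   star. *)
Notation star := (@None 'F_2).

Section Definitions.

Variables m n : nat.
Implicit Types (A : 'M[option 'F_2]_(m, n)) (W : {vspace 'cV['F_2]_n}).

Definition completion A (M : 'M['F_2]_(m, n)) : Prop :=
  forall i j a, A i j = Some a -> M i j = a.

Definition consistent A (G : 'cV['F_2]_n -> 'cV['F_2]_m) : Prop :=
  forall i (x y : 'cV['F_2]_n),
    (forall j, A i j = star -> x j 0 = y j 0) -> G x i 0 = G y i 0.

Definition solution A (L : {set 'cV['F_2]_n}) : Prop :=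
  exists (M : 'M['F_2]_(m, n)) (G : 'cV['F_2]_n -> 'cV['F_2]_m),
    [/\ completion A M, consistent A G & forall x, x \in L -> M *m x = G x].

(* The maximum over no rows is 0. *)
Definition max_stars A : nat := (\max_(i < m) #|[set j | A i j == star]|)%N.

Definition dotv (x y : 'cV['F_2]_n) : 'F_2 := \sum_j x j 0 * y j 0.

Definition weight (y : 'cV['F_2]_n) : nat := #|[set j | y j 0 == 1]|.

Definition orthv W : {set 'cV['F_2]_n} :=
  [set y | [forall x, (x \in W) ==> (dotv x y == 0)]].

(* [None] stands for the value +oo, taken when the orthogonal complement is
   trivial. *)
Definition codistance W : option nat :=
  if [pick y in orthv W :\ 0] is Some y0
  then Some (weight [arg min_(y < y0 in orthv W :\ 0) weight y])
  else None.

End Definitions.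

(* [d <= c] for [c] in the naturals extended with +oo, encoded as [None]. *)
Definition leq_ext (d : nat) (c : option nat) : bool :=
  if c is Some k then (d <= k)%N else true.

(* Main.v *)
Require Import Defs.
From HB Require Import structures.
From mathcomp Require Import all_boot all_order all_algebra.

Import GRing.Theory.
Local Open Scope ring_scope.

(** Let [S] be the set of stars of row [i].  A nonzero vector supported in [S]
    has weight at most [s], so it is not orthogonal to [W]; by duality the
    projection of [W] to the coordinates in [S] is onto.  Hence any two inputs
    of [g_i] can be replaced by vectors of [W], on which [g_i] agrees with the
    linear form given by row [i] of [M].  So [G] is linear, and the subspace
    [{x | M x = G x}] is a solution containing [L]. *)

Lemma codistance_leq_weight (n d : nat) (W : {vspace 'cV['F_2]_n})
    (y : 'cV['F_2]_n) :
  leq_ext d (codistance W) -> y \in orthv W -> y != 0 -> (d <= weight y)%N.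
Proof.
rewrite /codistance => + yW y0.
have yP : y \in orthv W :\ 0 by rewrite !inE y0; rewrite inE in yW.
(* The value [None] cannot occur, since [y] itself is a nonzero vector of the complement. *)
case: pickP => [y1 y1P|/(_ y)]; last by rewrite yP.
by case: arg_minnP => //= z _ /(_ y yP) le_zy le_dz; apply: leq_trans le_zy.
Qed.

Lemma codistance_lift (n : nat) (W : {vspace 'cV['F_2]_n}) (S : {set 'I_n})
    (v : 'cV['F_2]_n) :
  leq_ext #|S|.+1 (codistance W) ->
  exists2 x, x \in W & forall j, j \in S -> x j 0 = v j 0.
Proof.
move=> hW.
pose B := \matrix_(i < \dim W) ((vbasis W)`_i)^T.
pose P : 'M['F_2]_n := diag_mx (\row_j (j \in S)%:R).
have PE p (C : 'M['F_2]_(n, p)) i j : (P *m C) i j = (i \in S)%:R * C i j.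
  by rewrite mul_diag_mx !mxE.
have EP p (C : 'M['F_2]_(p, n)) i j : (C *m P) i j = C i j * (j \in S)%:R.
  by rewrite mul_mx_diag !mxE.
(* [B *m P] kills the cokernel, so each column of this product is orthogonal to the basis of [W].
   [P] makes it supported in [S], so the co-distance forces it to vanish. *)
have PC0 : P *m cokermx (B *m P) = 0.
  set C := cokermx _.
  have BPC : B *m (P *m C) = 0 by rewrite mulmxA mulmx_coker.
  apply/matrixP=> i k; rewrite [RHS]mxE.
  pose y := col k (P *m C).
  suff /eqP/matrixP/(_ i 0) : y == 0 by rewrite !mxE.
  apply/negPn/negP => y0.
  have yW : y \in orthv W.
    rewrite inE; apply/forallP=> x; apply/implyP=> /coord_vbasis ->.
    rewrite /dotv; apply/eqP.
    under eq_bigr => j _ do rewrite summxE mulr_suml.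
    rewrite exchange_big big1 // => l _.
    under eq_bigr => j _ do rewrite mxE -mulrA.
    rewrite -mulr_sumr; have /matrixP/(_ l k) := BPC.
    rewrite !mxE => BPC0; rewrite -[RHS](mulr0 (coord (vbasis W) l x)).
    congr (_ * _); rewrite -[RHS]BPC0.
    by apply: eq_bigr => j _; rewrite !mxE.
  have := codistance_leq_weight _ _ _ _ hW yW y0.
  rewrite ltnNge => /negP; apply; apply: subset_leq_card.
  by apply/subsetP=> j; rewrite inE mxE PE; case: (j \in S) => //.
(* The row space of [B *m P] consists of the rows killed by its cokernel. The coefficients [D] then
   combine the basis of [W] into the witness. *)
have /submxP[D vD] : (v^T *m P <= B *m P)%MS.
  by rewrite submxE -mulmxA PC0 mulmx0.
exists (D *m B)^T.
  have -> : (D *m B)^T = \sum_i D 0 i *: (vbasis W)`_i.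
    apply/matrixP=> j k; rewrite !mxE summxE ord1.
    by apply: eq_bigr => i _; rewrite !mxE.
  by apply: memv_suml => i _; rewrite memvZ // vbasis_mem // mem_nth // size_tuple.
move=> j jS; move/matrixP/(_ 0 j): vD; rewrite mulmxA !EP jS !mulr1 mxE => ->.
by rewrite mxE.
Qed.

Lemma consistent_linear (m n : nat) (A : 'M[option 'F_2]_(m, n))
    (M : 'M['F_2]_(m, n)) (G : 'cV['F_2]_n -> 'cV['F_2]_m)
    (W : {vspace 'cV['F_2]_n}) :
  consistent A G -> {in W, forall x, M *m x = G x} ->
  leq_ext (max_stars A).+1 (codistance W) -> linear G.
Proof.
move=> cG MG hW a x y; apply/matrixP=> i k; rewrite {k}ord1 !mxE.
pose S := [set j | A i j == star].
have hS : leq_ext #|S|.+1 (codistance W).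
  case: (codistance W) hW => //= d; apply: leq_trans.
  exact: (leq_bigmax (F := fun i => #|[set j | A i j == star]|)).
have starS j : A i j = star -> j \in S by rewrite inE => ->.
have [x' x'W xx'] := codistance_lift _ _ _ x hS.
have [y' y'W yy'] := codistance_lift _ _ _ y hS.
(* Consistency moves all three arguments of [G] into [W]: the subspace also contains [a *: x' + y'],
   which agrees with [a *: x + y] on [S]. *)
rewrite -(cG i x' x) => [|j /starS /xx' //].
rewrite -(cG i y' y) => [|j /starS /yy' //].
rewrite -(cG i (a *: x' + y') (a *: x + y)) => [|j /starS jS]; last first.
  by rewrite !mxE xx' // yy'.
by rewrite -!MG ?memvD ?memvZ // mulmxDr -scalemxAr !mxE.
Qed.

Theorem theorem5 (m n : nat) (A : 'M[option 'F_2]_(m, n))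
    (L : {set 'cV['F_2]_n}) (hL : solution A L)
    (W : {vspace 'cV['F_2]_n}) (hWL : {subset W <= L})
    (hW : leq_ext (max_stars A).+1 (codistance W)) :
  exists U : {vspace 'cV['F_2]_n},
    solution A [set x in U] /\ {subset L <= U}.
Proof.
case: hL => M [G [cM cG MG]].
have linG : linear G.
  by apply: consistent_linear cG _ hW => x /hWL; apply: MG.
(* The kernel of this map is the largest set on which the given [M] and [G] agree, so the same pair
   witnesses it as a solution. *)
have linF : linear (fun x => M *m x - G x).
  by move=> a x y; rewrite linG mulmxDr -scalemxAr scalerBr opprD addrACA.
pose F : {linear 'cV['F_2]_n -> 'cV['F_2]_m} :=
  HB.pack (fun x => M *m x - G x) (GRing.isLinear.Build _ _ _ _ _ linF).
have memU x : (x \in lker (linfun F)) = (M *m x == G x).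
  by rewrite memv_ker lfunE subr_eq0.
exists (lker (linfun F)); split=> [|x /MG xL]; last by rewrite memU xL.
by exists M, G; split=> // x; rewrite inE memU => /eqP.
Qed.
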